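(* Consider the finite-horizon linear benchmark serial supply chain described in the context, with tiers $1,\dots,n$, a fixed demand path $D=d$, deterministic initial conditions and zero shock pre-history. Assume the decision shocks $\epsilon_{j,t}$ are centered, independent across tiers and time, and satisfy $\operatorname{Var}(\epsilon_{j,t})=\sigma_j^2<\infty$ for all $j,t$. For a fixed facility $k\in\{1,\dots,n\}$, define $$W_{k,t}(d):=\operatorname{Var}(q_{k,t}\mid D=d).$$ Then $W_{k,t+1}(d)\ge W_{k,t}(d)$ for all $t$.
   Context: Time is $t=0,1,2,\dots$. Tier $0$ is external customer demand, $q_{0,t}=d_t$, a fixed deterministic real sequence once we condition on $D=d$; the decision shocks are independent of demand, so conditioning on $D=d$ does not alter their law. Each tier $k$ ($1\le k\le n$) has an order-up-to multiplier $\theta_k>0$, a smoothing parameter $\lambda_k\in(0,1]$, and real processes $q_{k,t}$ (order), $IP_{k,t}$ (inventory position), $\hat q_{k,t}$ (forecast) and decision shock $\epsilon_{k,t}$, with $$q_{k,t}=\theta_k\hat q_{k,t}+\epsilon_{k,t}-IP_{k,t},\qquad IP_{k,t+1}=IP_{k,t}+q_{k,t}-q_{k-1,t}\qquad(t\ge0),$$ $$\hat q_{k,t}=\lambda_k q_{k-1,t-1}+(1-\lambda_k)\hat q_{k,t-1}\qquad(t\ge1).$$ Deterministic initial conditions means that $IP_{k,0}$ and $\hat q_{k,0}$ are deterministic constants for every tier $k$; zero shock pre-history means that there are no shocks before time $0$. *)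

(* Defs.v *)
From mathcomp Require Import all_boot all_order all_algebra finmap.
From mathcomp Require Import all_classical all_reals all_analysis.

Set Implicit Arguments.
Unset Strict Implicit.
Unset Printing Implicit Defensive.

Import Order.TTheory GRing.Theory Num.Theory.
Import numFieldNormedType.Exports.

Local Open Scope classical_set_scope.
Local Open Scope ring_scope.

(* Mutual independence of the subfamily of X indexed by the (possibly
   infinite) set D: product rule over every finite subset of D. *)
Definition independent_RVs (disp : measure_display) (T : measurableType disp)
    (R : realType) (P : probability T R) (I : choiceType) (D : set I)
    (X : I -> {RV P >-> R}) : Prop :=
  forall (J : {fset I}) (A : I -> set R),
    [set` J] `<=` D ->
    (forall i, i \in J -> measurable (A i)) ->
    P (\bigcap_(i in [set` J]) (X i @^-1` A i)) =
    (\prod_(i <- J) P (X i @^-1` A i))%E.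

(* The first index of q, IP, qhat, eps is the tier and the second is time.
   Only tiers 0..n of q and tiers 1..n of IP, qhat, eps, theta, lambda are
   constrained.  Processes live on times t >= 0, so there is no shock before
   time 0, and the forecast recursion at tier k is written between t and t+1. *)
Record serial_supply_chain (T : Type) (R : realType) (n : nat)
    (theta lambda : nat -> R) (d : nat -> R) (IP0 qhat0 : nat -> R)
    (eps q IP qhat : nat -> nat -> T -> R) : Prop := SerialSupplyChain {
  chain_theta_gt0 : forall k, (1 <= k <= n)%N -> 0 < theta k;
  chain_lambda_bounds : forall k, (1 <= k <= n)%N -> 0 < lambda k <= 1;
  chain_demand : forall t w, q 0%N t w = d t;
  chain_IP_init : forall k, (1 <= k <= n)%N -> forall w, IP k 0%N w = IP0 k;
  chain_qhat_init :
    forall k, (1 <= k <= n)%N -> forall w, qhat k 0%N w = qhat0 k;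
  chain_order : forall k, (1 <= k <= n)%N -> forall t w,
    q k t w = theta k * qhat k t w + eps k t w - IP k t w;
  chain_IP : forall k, (1 <= k <= n)%N -> forall t w,
    IP k t.+1 w = IP k t w + q k t w - q k.-1 t w;
  chain_forecast : forall k, (1 <= k <= n)%N -> forall t w,
    qhat k t.+1 w = lambda k * q k.-1 t w + (1 - lambda k) * qhat k t w
}.

(* W_{k,t}(d) = Var(q_{k,t} | D = d).  Here P is the law conditioned on D = d
   and q is driven by the path d, so this is the variance under P. *)
Definition order_variance (disp : measure_display) (T : measurableType disp)
    (R : realType) (P : probability T R) (q : nat -> nat -> T -> R)
    (k t : nat) : \bar R :=
  ('V_P[q k t])%E.

(* Main.v *)
From HB Require Import structures.
Require Import Defs.
From mathcomp Require Import all_boot all_order all_algebra finmap.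
From mathcomp Require Import all_classical all_reals all_analysis.
From mathcomp Require Import measurable_realfun ring.

Import Order.TTheory GRing.Theory Num.Theory.
Import numFieldNormedType.Exports.

Local Open Scope classical_set_scope.
Local Open Scope ring_scope.

(** In every tier the order process is a deterministic path plus a causal,
    time-invariant linear filter of the shocks, because deterministic affine
    combinations and affine first-order recursions with constant coefficients
    preserve this form.  Uncorrelatedness turns the variance at time [t] into
    the sum over tiers [j] and lags [m <= t] of [h_j(m)^2 sigma_j^2]; passing
    from [t] to [t + 1] only adds the nonnegative terms of lag [t + 1]. *)

Definition shock_filter (T : Type) (R : realType) (n : nat)
    (eps : nat -> nat -> T -> R) (f : nat -> T -> R) : Prop :=
  exists (c : nat -> R) (h : nat -> nat -> R), forall t w,
    f t w = c t + \sum_(j < n) \sum_(s < t.+1) h j (t - s)%N * eps j.+1 s w.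

Arguments shock_filter {T R}.

(** * Closure properties of causal time-invariant filters of the shocks *)

Section ShockFilter.
Context {T : Type} {R : realType} {n : nat} {eps : nat -> nat -> T -> R}.
Local Notation filter := (shock_filter n eps).

Lemma shock_filter_cst (c : nat -> R) : filter (fun t _ => c t).
Proof.
exists c, (fun _ _ => 0) => t w; rewrite big1 ?addr0// => j _.
by rewrite big1// => s _; rewrite mul0r.
Qed.

Lemma shock_filter_lin (a b : R) f g :
  filter f -> filter g -> filter (fun t w => a * f t w + b * g t w).
Proof.
move=> [c1 [h1 E1]] [c2 [h2 E2]].
exists (fun t => a * c1 t + b * c2 t), (fun j m => a * h1 j m + b * h2 j m).
move=> t w; rewrite E1 E2 !mulrDr addrACA; congr (_ + _).
rewrite !mulr_sumr -big_split; apply: eq_bigr => j _ /=.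
rewrite !mulr_sumr -big_split; apply: eq_bigr => s _ /=.
by rewrite mulrDl !mulrA.
Qed.

Lemma shock_filter_shock k : (1 <= k <= n)%N -> filter (eps k).
Proof.
move=> /andP[k0 kn].
(* The kernel is a unit impulse at lag 0 in tier [k]; the summation index [j] stands for tier
   [j.+1]. *)
exists (fun=> 0), (fun j m => ((j.+1 == k) && (m == 0))%:R) => t w.
have kn' : (k.-1 < n)%N by rewrite prednK.
rewrite add0r (bigD1 (Ordinal kn'))//= prednK// eqxx big_ord_recr/=.
rewrite subnn mul1r !big1 ?add0r ?addr0//.
- move=> j jk; apply: big1 => s _; case: eqP => [jk'|_]; last by rewrite mul0r.
  by case/eqP: jk; apply: val_inj; rewrite /= -jk'.
- by move=> s _; rewrite subn_eq0 leqNgt ltn_ord mul0r.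
Qed.

(** Unrolling the recursion gives the kernel h(p+1) = a h(p) + hf(p). It starts from h(0) = 0
    because [g] at time t+1 sees only shocks up to time t, and [g] at time 0 is deterministic. *)
Lemma shock_filter_rec (a g0 : R) f g :
  filter f -> (forall w, g 0%N w = g0) ->
  (forall t w, g t.+1 w = a * g t w + f t w) -> filter g.
Proof.
move=> [cf [hf Ef]] G0 GS.
pose c := fix c t := if t is u.+1 then a * c u + cf u else g0.
pose h j := fix hj m := if m is p.+1 then a * hj p + hf j p else 0.
exists c, h => t w; elim: t => [|t IHt].
  rewrite G0 [X in _ + X]big1 ?addr0// => j _.
  by rewrite big_ord_recr big_ord0/= mul0r addr0.
rewrite GS IHt Ef mulrDr addrACA; congr (_ + _).
rewrite mulr_sumr -big_split; apply: eq_bigr => j _ /=.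
(* The shock at time t+1 has lag 0 and drops out; each earlier one gains one lag. *)
rewrite [RHS]big_ord_recr/= subnn mul0r addr0 mulr_sumr -big_split.
apply: eq_bigr => s _ /=; rewrite subSn -1?ltnS//=.
by rewrite mulrDl mulrA.
Qed.

Lemma eq_shock_filter f g : (forall t w, f t w = g t w) -> filter f -> filter g.
Proof. by move=> fg [c [h E]]; exists c, h => t w; rewrite -fg. Qed.

(** Induction on the tier, starting from the shock-free demand. Within a tier, the filter form
    passes from the incoming orders to the forecast, then to the inventory position, then to the
    order. *)
Lemma shock_filter_order theta lambda d IP0 qhat0 q IP qhat :
  serial_supply_chain n theta lambda d IP0 qhat0 eps q IP qhat ->
  forall k, (k <= n)%N -> filter (q k).
Proof.
move=> C; elim=> [_|k IHk kn].
  apply: eq_shock_filter (shock_filter_cst d) => t w.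
  by rewrite (chain_demand C).
have k1n : (1 <= k.+1 <= n)%N by [].
have Fe := shock_filter_shock _ k1n.
have Fq := IHk (ltnW kn).
have Fqhat : filter (qhat k.+1).
  (* The term with coefficient 0 only puts the forcing into the two-term shape of
     [shock_filter_lin]. *)
  apply: (@shock_filter_rec (1 - lambda k.+1) (qhat0 k.+1)
    (fun t w => lambda k.+1 * q k t w + 0 * q k t w)).
  - exact: shock_filter_lin.
  - exact: (chain_qhat_init C).
  - by move=> t w; rewrite (chain_forecast C)//; ring.
have Fdemand := shock_filter_lin (theta k.+1) 1 _ _ Fqhat Fe.
(* IP_{t+1} = theta qhat_t + eps_t - q_{k-1,t}: the order restores the target. *)
have FIP : filter (IP k.+1).
  apply: (shock_filter_rec 0 (IP0 k.+1) _ _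
    (shock_filter_lin 1 (-1) _ _ Fdemand Fq)).
  - exact: (chain_IP_init C).
  - by move=> t w; rewrite (chain_IP C)// (chain_order C)//=; ring.
apply: eq_shock_filter (shock_filter_lin 1 (-1) _ _ Fdemand FIP) => t w.
by rewrite (chain_order C)//; ring.
Qed.

End ShockFilter.

(** * Square integrability, independence and variances of sums *)

Section Uncorrelated.
Local Open Scope ereal_scope.
Context d (T : measurableType d) (R : realType) (P : probability T R).

Lemma Lfun2_Lfun1 (X : T -> R) : X \in Lfun P 2%:E -> X \in Lfun P 1.
Proof. by apply: Lfun_subset12; rewrite fin_num_measure. Qed.

(** For a centered variable the variance is the integral of the square, so its finiteness bounds the
    L2 norm. *)
Lemma centered_variance_Lfun2 (X : {RV P >-> R}) :
  'E_P[X] = 0 -> 'V_P[X] < +oo -> (X : T -> R) \in Lfun P 2%:E.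
Proof.
move=> EX; rewrite /variance unlock EX/= expectation.unlock => VX.
rewrite inE; apply/andP; split; rewrite inE//=.
rewrite /finite_norm unlock/= poweR_lty//.
apply: le_lt_trans VX; apply: ge0_le_integral => //=.
- apply/measurable_EFinP; apply: (measurableT_comp (measurable_powR _)) => //.
  exact: measurableT_comp.
- by apply/measurable_EFinP; apply: measurable_funM; apply: measurable_funB.
- move=> x _; rewrite lee_fin !fctE/= subr0 powR_mulrn//.
  by rewrite -normrX ger0_norm ?sqr_ge0.
Qed.

(** Both sides become integrals of (x, y) |-> x y, one against the joint law and one against the
    product of the marginals. *)
Lemma expectationM_independent (X Y : {RV P >-> R}) :
  (forall A B, measurable A -> measurable B ->
    P (X @^-1` A `&` Y @^-1` B) = P (X @^-1` A) * P (Y @^-1` B)) ->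
  (X : T -> R) \in Lfun P 1 -> (Y : T -> R) \in Lfun P 1 ->
  (X * Y : T -> R)%R \in Lfun P 1 -> 'E_P[X * Y] = 'E_P[X] * 'E_P[Y].
Proof.
move=> XY X1 Y1 XY1.
have mZ : measurable_fun setT (fun w => (X w, Y w)).
  exact: measurable_fun_pair.
pose Zm := isMeasurableFun.Build _ _ _ _ _ mZ.
pose Z : {RV P >-> (R * R)%type} := HB.pack (fun w => (X w, Y w)) Zm.
pose f (z : R * R) := (z.1 * z.2)%:E.
have mf : measurable_fun setT f.
  by apply/measurable_EFinP; apply: measurable_funM.
have iXY : P.-integrable setT (f \o Z) by exact/Lfun1_integrable.
(* Fubini applies because the joint law is the product of the marginals. *)
have law A : measurable A ->
    (distribution P X \x distribution P Y) A = distribution P Z A.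
  by apply: product_measure_unique => B C mB mC; rewrite -XY.
(* Integrability of [X * Y] under [P] is carried to the product law by a change of variables in the
   integral of the absolute value. *)
have lawint : (distribution P X \x distribution P Y).-integrable setT f.
  apply/integrableP; split=> //.
  rewrite (eq_measure_integral (distribution P Z)); last first.
    by move=> A mA _; apply: law.
  rewrite ge0_integral_distribution//; last exact: measurableT_comp.
  by case/integrableP: iXY.
have EXE : \int[distribution P X]_x x%:E = 'E_P[X].
  rewrite expectation.unlock; apply: integral_distribution => //.
  exact/Lfun1_integrable.
have EYE : \int[distribution P Y]_y y%:E = 'E_P[Y].
  rewrite expectation.unlock; apply: integral_distribution => //.
  exact/Lfun1_integrable.
transitivity (\int[distribution P Z]_z f z).
  by rewrite expectation.unlock integral_distribution.
rewrite (eq_measure_integral (distribution P X \x distribution P Y)); last first.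
  by move=> A mA _; exact: esym (law A mA).
rewrite -integral12_prod_meas1// /fubini_F /f/=.
have iY : (distribution P Y).-integrable setT EFin.
  by apply: integrable_pushforward => //; exact/Lfun1_integrable.
have iX : (distribution P X).-integrable setT EFin.
  by apply: integrable_pushforward => //; exact/Lfun1_integrable.
under eq_integral => x _.
  under eq_integral do rewrite EFinM.
  rewrite integralZl// EYE -(fineK (expectation_fin_num Y1)).
over.
by rewrite /= integralZr// EXE fineK// expectation_fin_num.
Qed.

(** Mutual independence is applied to the set {i, j}; [i != j] makes its product have exactly two
    factors. *)
Lemma independent_RVs_pair (I : choiceType) (D : set I) (X : I -> {RV P >-> R})
    (i j : I) (A B : set R) :
  independent_RVs D X -> D i -> D j -> i != j ->
  measurable A -> measurable B ->
  P (X i @^-1` A `&` X j @^-1` B) = P (X i @^-1` A) * P (X j @^-1` B).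
Proof.
move=> XI Di Dj ij mA mB; pose C p := if p == i then A else B.
have Ci : C i = A by rewrite /C eqxx.
have Cj : C j = B by rewrite /C eq_sym (negPf ij).
have := XI [fset i; j]%fset C.
rewrite big_fsetU1/= ?inE// big_seq_fset1 Ci Cj => <-.
- congr (P _); apply/seteqP; split=> w /=.
    by move=> [Aw Bw] p /=; rewrite !inE => /orP[]/eqP ->; rewrite ?Ci ?Cj.
  move=> H; split.
    by rewrite -Ci; apply: H; rewrite /= !inE eqxx.
  by rewrite -Cj; apply: H; rewrite /= !inE eqxx orbT.
- by move=> p /=; rewrite !inE => /orP[]/eqP ->.
- by move=> p _; rewrite /C; case: ifP.
Qed.

Lemma Lfun2_sum (I : Type) (s : seq I) (X : I -> T -> R) :
  (forall i, X i \in Lfun P 2%:E) -> (\sum_(i <- s) X i)%R \in Lfun P 2%:E.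
Proof. by move=> X2; rewrite rpred_sum ?lee1n. Qed.

Lemma covariance_sumr (I : Type) (s : seq I) (X : T -> R) (Y : I -> T -> R) :
  X \in Lfun P 2%:E -> (forall i, Y i \in Lfun P 2%:E) ->
  covariance P X (\sum_(i <- s) Y i)%R = \sum_(i <- s) covariance P X (Y i).
Proof.
move=> X2 Y2; elim: s => [|i s IHs].
  by rewrite !big_nil; apply: covariance_cst_r.
by rewrite !big_cons covarianceDr ?IHs ?Lfun2_sum.
Qed.

(** The covariance of the head with the rest vanishes termwise, since [uniq] keeps the head out of
    the tail. *)
Lemma variance_sum_uncorrelated (I : eqType) (s : seq I) (X : I -> T -> R) :
  uniq s -> (forall i, X i \in Lfun P 2%:E) ->
  (forall i j, i != j -> covariance P (X i) (X j) = 0) ->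
  'V_P[(\sum_(i <- s) X i)%R] = \sum_(i <- s) 'V_P[X i].
Proof.
move=> + X2 X0; elim: s => [_|i s IHs /= /andP[si us]].
  by rewrite !big_nil; apply: variance_cst.
rewrite !big_cons varianceD ?Lfun2_sum// IHs// covariance_sumr//.
rewrite [X in 2%:E * X](_ : _ = 0) ?mule0 ?adde0//.
rewrite big_seq; apply: big1 => j js.
by apply: X0; apply: contraNneq si => ->.
Qed.

End Uncorrelated.

(** * Expansion of the order variance by lags, and monotonicity *)

Theorem mainTheorem3 (R : realType) (disp : measure_display)
    (T : measurableType disp) (P : probability T R)
    (n : nat) (theta lambda sigma : nat -> R) (d : nat -> R)
    (IP0 qhat0 : nat -> R)
    (eps : nat -> nat -> {RV P >-> R})
    (q IP qhat : nat -> nat -> T -> R)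
    (Hchain : serial_supply_chain n theta lambda d IP0 qhat0
                (fun j t => eps j t : T -> R) q IP qhat)
    (Hcentered : forall j t, (1 <= j <= n)%N -> ('E_P[eps j t] = 0)%E)
    (Hvar : forall j t, (1 <= j <= n)%N -> ('V_P[eps j t] = (sigma j ^+ 2)%:E)%E)
    (Hindep : independent_RVs [set jt : nat * nat | (1 <= jt.1 <= n)%N]
                (fun jt => eps jt.1 jt.2))
    (k : nat) (hk : (1 <= k <= n)%N) :
  forall t : nat,
    (order_variance P q k t <= order_variance P q k t.+1)%E.
Proof.
have eps2 j t : (1 <= j <= n)%N -> (eps j t : T -> R) \in Lfun P 2%:E.
  by move=> jn; apply: centered_variance_Lfun2; rewrite ?Hcentered ?Hvar ?ltry.
have cov0 i s j t : (1 <= i <= n)%N -> (1 <= j <= n)%N -> (i, s) != (j, t) ->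
    covariance P (eps i s) (eps j t) = 0%E.
  move=> i_n jn ij.
  have [X2 Y2] := (eps2 i s i_n, eps2 j t jn).
  have [X1 Y1] := (Lfun2_Lfun1 _ _ _ _ _ X2, Lfun2_Lfun1 _ _ _ _ _ Y2).
  have XY1 := Lfun2_mul_Lfun1 X2 Y2.
  rewrite covarianceE// expectationM_independent// ?Hcentered ?mule0 ?sube0//.
  by move=> A B mA mB; apply: independent_RVs_pair Hindep _ _ ij mA mB.
have [c [h E]] : shock_filter n (fun j t => eps j t : T -> R) (q k).
  by apply: shock_filter_order Hchain _ _; case/andP: hk.
have V t : order_variance P q k t =
    (\sum_(j < n) \sum_(m < t.+1) (h j m ^+ 2 * sigma j.+1 ^+ 2))%:E.
  have eps2' (j : 'I_n) s : (eps j.+1 s : T -> R) \in Lfun P 2%:E.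
    by rewrite eps2// ltn_ord.
  (* [X p] is the contribution to the order at time [t] of the single shock of tier [p.1.+1] at time
     [p.2]. *)
  pose X (p : 'I_n * 'I_t.+1) : T -> R := h p.1 (t - p.2)%N \o* eps p.1.+1 p.2.
  have X2 p : X p \in Lfun P 2%:E by rewrite Lfun_scale ?ler1n// eps2'.
  have qE : q k t = cst (c t) \+ \sum_p X p.
    apply/funext => w; rewrite E /= fct_sumE pair_big/=; congr (_ + _).
    by apply: eq_bigr => p _; rewrite mulrC.
  rewrite /order_variance qE varianceD_cst_l ?Lfun2_sum//.
  rewrite variance_sum_uncorrelated ?index_enum_uniq//; last first.
    move=> [i r] [j s] ij; have [Y2 Z2] := (eps2' i r, eps2' j s).
    have [Y1 Z1] := (Lfun2_Lfun1 _ _ _ _ _ Y2, Lfun2_Lfun1 _ _ _ _ _ Z2).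
    rewrite /X covarianceZl ?Lfun_scale//; last first.
      by apply: Lfun2_mul_Lfun1; rewrite ?Lfun_scale ?ler1n.
    rewrite covarianceZr//; last exact: Lfun2_mul_Lfun1.
    by rewrite cov0 ?mule0// ltn_ord.
  transitivity (\sum_(p : 'I_n * 'I_t.+1) (h p.1 (t - p.2)%N ^+ 2 *
      sigma p.1.+1 ^+ 2)%:E)%E.
    by apply: eq_bigr => p _; rewrite varianceZ// Hvar ?ltn_ord// EFinM.
  rewrite sumEFin -(pair_big xpredT xpredT (fun (j : 'I_n) (s : 'I_t.+1) =>
    h j (t - s)%N ^+ 2 * sigma j.+1 ^+ 2))/=.
  congr EFin; apply: eq_bigr => j _.
  (* The reversal s |-> t - s replaces shock times by lags, after which the summand no longer
     depends on [t]. *)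
  rewrite (reindex_inj rev_ord_inj); apply: eq_bigr => m _ /=.
  by rewrite subSS subKn -1?ltnS.
move=> t; rewrite !V lee_fin; apply: ler_sum => j _.
by rewrite [leRHS]big_ord_recr lerDl mulr_ge0 ?sqr_ge0.
Qed.
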